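(* Let $p,q$ be positive integers and $d>1$ a divisor of $pq$. If $H(p,q,d)$ is a line digraph (i.e. isomorphic to $L(G')$ for some digraph $G'$), then $\gcd(p,q)$ is a multiple of $d$.
   Context: For integers $a\le b$, $[a,b]=\{c\in\mathbb{Z}: a\le c\le b\}$. Digraphs may have loops and multiple arcs. For positive integers $p,q$, every $a\in[0,pq-1]$ is written uniquely as $a=iq+j$ with $i\in[0,p-1]$, $j\in[0,q-1]$, denoted $a=(i,j)_{p,q}$. For a divisor $d>1$ of $pq$, the digraph $H(p,q,d)$ has vertex set $[0,pq/d-1]$, where vertex $k$ represents the block $[kd,kd+d-1]$; for each $i\in[0,p-1]$, $j\in[0,q-1]$ there is one arc from the vertex whose block contains $iq+j$ to the vertex whose block contains $(q-1-j)p+(p-1-i)$ (arcs counted with multiplicity). The line digraph $L(G)$ of a digraph $G$ has the arcs of $G$ as vertices, with an arc from $(u,v)$ to $(v,w)$ whenever these are arcs of $G$. *)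

(* Defs.v *)
From mathcomp Require Import all_boot.

Set Implicit Arguments.
Unset Strict Implicit.
Unset Printing Implicit Defensive.

(* Arcs form a type of their own, so loops and multiple arcs are allowed.
   No finiteness is imposed; equality is only required to be decidable. *)
Record digraph := Digraph {
  vertex : eqType;
  arc : eqType;
  source : arc -> vertex;
  target : arc -> vertex
}.

(* The bijection on arcs makes isomorphisms preserve arc multiplicities. *)
Definition digraph_iso (G1 G2 : digraph) : Prop :=
  exists (fv : vertex G1 -> vertex G2) (fa : arc G1 -> arc G2),
    [/\ bijective fv, bijective fa,
        forall a : arc G1, source (fa a) = fv (source a)
      & forall a : arc G1, target (fa a) = fv (target a)].

(* One arc for each pair of consecutive arcs of G. Distinct parallel arcs of G
   are distinct vertices of the line digraph. The test is boolean so that an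
   arc carries no information besides the pair itself. *)
Definition line_digraph (G : digraph) : digraph :=
  @Digraph (arc G) {ab : arc G * arc G | target ab.1 == source ab.2}
    (fun ab => (val ab).1) (fun ab => (val ab).2).

Definition is_line_digraph (G : digraph) : Prop :=
  exists G' : digraph, digraph_iso G (line_digraph G').

Section H_digraph.

Variables p q d : nat.

Definition H_tail (ij : 'I_p * 'I_q) : nat := ij.1 * q + ij.2.

Definition H_head (ij : 'I_p * 'I_q) : nat :=
  (q - 1 - ij.2) * p + (p - 1 - ij.1).

Lemma digits_lt (m n a b : nat) : a < m -> b < n -> a * n + b < m * n.
Proof.
move=> lt_am lt_bn; apply: (@leq_trans (a.+1 * n)).
  by rewrite mulSn addnC ltn_add2r.
by rewrite leq_mul2r lt_am orbT.
Qed.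

Lemma H_tail_lt ij : H_tail ij < p * q.
Proof. exact: digits_lt. Qed.

Lemma H_head_lt ij : H_head ij < p * q.
Proof.
case: ij => [[i lt_ip] [j lt_jq]]; rewrite /H_head /= mulnC [p * q]mulnC.
rewrite [p * _]mulnC; apply: digits_lt.
  by rewrite -subnDA add1n ltn_subrL (leq_trans _ lt_jq).
by rewrite -subnDA add1n ltn_subrL (leq_trans _ lt_ip).
Qed.

Lemma block_lt x : d %| p * q -> x < p * q -> x %/ d < p * q %/ d.
Proof.
move=> dvd_d lt_x; have d_gt0 : 0 < d.
  by apply: dvdn_gt0 dvd_d; apply: leq_ltn_trans lt_x.
by rewrite ltn_divLR // divnK.
Qed.

(* The quotient x %/ d is the index of the block containing x. *)
Lemma in_blockE k x : 0 < d -> (k * d <= x <= k * d + d - 1) = (x %/ d == k).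
Proof.
move=> d_gt0; rewrite eqn_leq andbC leq_divRL //; congr (_ && _).
by rewrite -ltnS -[RHS]ltnS ltn_divLR // subn1 prednK ?mulSn 1?addnC //
  addn_gt0 d_gt0.
Qed.

Hypothesis dvd_d : d %| p * q.

Definition H_digraph : digraph :=
  @Digraph 'I_(p * q %/ d) ('I_p * 'I_q)%type
    (fun ij => Ordinal (block_lt dvd_d (H_tail_lt ij)))
    (fun ij => Ordinal (block_lt dvd_d (H_head_lt ij))).

End H_digraph.

(* Main.v *)
Require Import Defs.
From mathcomp Require Import all_boot.
From mathcomp Require Import zify.

(** View the arcs as the cells of a p x q grid. Two arcs have the same tail when
    their cells lie in the same d-block of the row-major numbering and, after
    reversing the order of the blocks, the same head when they lie in the same
    d-block of the column-major numbering. A line digraph has no parallel arcs,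
    and any two of its vertices with a common out-neighbour have the same
    out-neighbours. The first property forces d <= p and d <= q. If d did not
    divide q, the row block of (1, 0) would start in row 0; it shares a column
    block with (0, 0), hence out-neighbours with the row block of (0, 0), so it
    meets the column block of (0, d - 1): a look at positions excludes this.
    Both properties are invariant under transposing the grid, so d divides p
    too. *)

Definition no_parallel_arcs (G : digraph) : Prop :=
  forall a b : Defs.arc G, source a = source b -> target a = target b -> a = b.

Definition arc_completion (G : digraph) : Prop :=
  forall a b c : Defs.arc G, source a = source b -> target b = target c ->
  exists e : Defs.arc G, source e = source c /\ target e = target a.

(** An arc of a line digraph is nothing but the pair of its ends. *)
Lemma line_digraph_no_parallel_arcs (G : digraph) :
  is_line_digraph G -> no_parallel_arcs G.
Proof.
case=> G' [fv [fa [_ /bij_inj fa_inj src tgt]]] a b sab tab.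
apply: fa_inj; apply: val_inj.
have := src a; have := tgt a; rewrite sab tab -src -tgt /=.
by case: (\val (fa a)) (\val (fa b)) => [x y] [z t] /= -> ->.
Qed.

(** As pairs of arcs of [G'], [a], [b] and [c] all pass through one middle vertex, so the first arc
    of [c] can be followed by the second arc of [a]. *)
Lemma line_digraph_arc_completion (G : digraph) :
  is_line_digraph G -> arc_completion G.
Proof.
case=> G' [fv [fa [/bij_inj fv_inj [ga _ faK] src tgt]]] a b c sab tbc.
have sab' : (val (fa a)).1 = (val (fa b)).1.
  by move: (src a) (src b) => /= -> ->; rewrite sab.
have tbc' : (val (fa b)).2 = (val (fa c)).2.
  by move: (tgt b) (tgt c) => /= -> ->; rewrite tbc.
have Ee : target (val (fa c)).1 == source (val (fa a)).2.
  rewrite (eqP (valP (fa c))) -tbc' -(eqP (valP (fa b))) -sab'.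
  exact: valP (fa a).
exists (ga (exist _ ((val (fa c)).1, (val (fa a)).2) Ee)).
by split; apply: fv_inj; rewrite -(src, tgt) -(src, tgt) faK.
Qed.

Definition row_block (q d : nat) (x : nat * nat) : nat := (x.1 * q + x.2) %/ d.

Definition col_block (p d : nat) (x : nat * nat) : nat := (x.2 * p + x.1) %/ d.

Definition in_grid (p q : nat) (x : nat * nat) : Prop := x.1 < p /\ x.2 < q.

Definition blocks_meet_once (p q d : nat) : Prop :=
  forall x y, in_grid p q x -> in_grid p q y ->
  row_block q d x = row_block q d y -> col_block p d x = col_block p d y ->
  x = y.

Definition blocks_complete (p q d : nat) : Prop :=
  forall x y z, in_grid p q x -> in_grid p q y -> in_grid p q z ->
  row_block q d x = row_block q d y -> col_block p d y = col_block p d z ->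
  exists w, [/\ in_grid p q w, row_block q d w = row_block q d z
              & col_block p d w = col_block p d x].

Lemma blocks_meet_once_tr (p q d : nat) :
  blocks_meet_once p q d -> blocks_meet_once q p d.
Proof.
move=> H [i j] [k l] [/= ? ?] [/= ? ?] rb cb.
by suff [-> ->] : (j, i) = (l, k) by []; apply: H.
Qed.

Lemma blocks_complete_tr (p q d : nat) :
  blocks_complete p q d -> blocks_complete q p d.
Proof.
move=> H [i j] [k l] [m n] [/= ? ?] [/= ? ?] [/= ? ?] rb cb.
(* Transposing exchanges the two kinds of blocks, so the outer cells swap roles. *)
case: (H (n, m) (l, k) (j, i)) => // -[s t] [[/= ? ?] rw cw].
by exists (t, s).
Qed.

Lemma blocks_meet_once_leq (p q d : nat) :
  0 < p -> 0 < q -> 1 < d -> d %| p * q -> blocks_meet_once p q d -> d <= p.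
Proof.
move=> p_gt0 q_gt0 d_gt1 dvd_d H; rewrite leqNgt; apply/negP => lt_pd.
have [q_gt1|] := ltnP 1 q; last first.
  move=> q_le1; have Eq : q = 1 by lia.
  by move: dvd_d; rewrite Eq muln1 => /(dvdn_leq p_gt0); rewrite leqNgt lt_pd.
(* The row-major numbers are 0 and 1, the column-major ones 0 and [p], all below [d]. *)
suff: (0, 0) = (0, 1) by [].
apply: H => //=.
- by rewrite /row_block /= !mul0n !add0n !divn_small //; lia.
- by rewrite /col_block /= mul0n mul1n !addn0 !divn_small //; lia.
Qed.

Lemma blocks_complete_dvdn (p q d : nat) :
  1 < d -> d <= p -> d <= q -> blocks_complete p q d -> d %| q.
Proof.
move=> d_gt1 le_dp le_dq H; apply/negPn/negP; rewrite /dvdn -lt0n => r_gt0.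
case: (H (0, d.-1) (0, 0) (1, 0)).
- by split=> /=; lia.
- by split=> /=; lia.
- by split=> /=; lia.
- by rewrite /row_block /= !mul0n !add0n !divn_small //; lia.
- by rewrite /col_block /= !mul0n !add0n !divn_small //; lia.
case=> i j [[/= lt_ip lt_jq]].
rewrite /row_block /col_block /= mul1n !addn0 => rb cb.
have d_gt0 : 0 < d by lia.
have r_lt := ltn_pmod q d_gt0.
have Eq := divn_eq q d.
have q_div : 0 < q %/ d by rewrite divn_gt0.
have Ex := divn_eq (i * q + j) d; have x_lt := ltn_pmod (i * q + j) d_gt0.
rewrite rb in Ex.
have Ey := divn_eq (j * p + i) d; have y_lt := ltn_pmod (j * p + i) d_gt0.
have Et := divn_eq (d.-1 * p) d; have t_lt := ltn_pmod (d.-1 * p) d_gt0.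
have le_d : d <= q %/ d * d by rewrite leq_pmull.
(* Row 2 starts at [2 * q >= q + d], past the row block of [q]. *)
have i_le1 : i <= 1 by rewrite leqNgt; apply/negP => i_gt1; nia.
have j_lt_d : j < d.
  (* Column [d] starts at [d * p >= d.-1 * p + d], past the column block of [d.-1 * p]. *)
  rewrite ltnNge; apply/negP => le_dj.
  have : d * p <= j * p by rewrite leq_mul2r le_dj orbT.
  rewrite cb in Ey; nia.
(* In row 0 the number would be [j < d], before the block of [q], which starts at [d] or later. *)
have Ei : i = 1 by case: i i_le1 {rb cb Ey y_lt lt_ip x_lt} Ex => [|[|]]; lia.
subst i.
(* [q] sits at the positive offset [q %% d] in its block, and [q + j] stays in that block. *)
have j_le : j <= d - 2 by lia.
have jp : j * p <= (d - 2) * p by rewrite leq_mul2r j_le orbT.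
have Ed : d.-1 * p = (d - 2) * p + p by rewrite -mulSnr; congr (_ * _); lia.
(* From column [d - 2] or earlier, row 1 reaches the block of [d.-1 * p] only if [p <= d]. Column
   blocks are then whole columns, forcing [j = d.-1]. *)
have Ep : p = d by rewrite cb in Ey; lia.
subst p; move: cb; rewrite mulnK // divnMDl // divn_small //; lia.
Qed.

Lemma divn_rev (n d y : nat) :
  0 < d -> y < n * d -> (n * d - 1 - y) %/ d = n - 1 - y %/ d.
Proof.
move=> d_gt0 lt_y; have Ey := divn_eq y d; have r_lt := ltn_pmod y d_gt0.
have k_lt : y %/ d < n by rewrite ltn_divLR.
have -> : n * d - 1 - y = (n - 1 - y %/ d) * d + (d - 1 - y %% d).
  have : (y %/ d).+1 * d <= n * d by rewrite leq_mul2r k_lt orbT.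
  rewrite mulSn !mulnBl mul1n; move: Ey r_lt {k_lt}.
  by move: (y %/ d * d) (y %% d) => kd r; lia.
by rewrite divnMDl // [X in _ + X]divn_small ?addn0 // -subnDA ltn_subrL d_gt0.
Qed.

(** [H_head] is [p * q - 1] minus the column-major number. *)
Lemma H_head_block (p q d : nat) (ij : 'I_p * 'I_q) :
  0 < d -> d %| p * q ->
  H_head ij %/ d = p * q %/ d - 1 - col_block p d (val ij.1, val ij.2).
Proof.
case: ij => [[i lt_ip] [j lt_jq]] d_gt0 dvd_d; rewrite /H_head /col_block /=.
rewrite -divn_rev ?divnK // [p * q]mulnC ?digits_lt //; congr (_ %/ d).
have : j.+1 * p <= q * p by rewrite leq_mul2r lt_jq orbT.
by rewrite !mulnBl mulSn mul1n; lia.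
Qed.

Section GridOfArcs.

Variables (p q d : nat) (d_gt0 : 0 < d) (dvd_d : d %| p * q).

Let G : digraph := H_digraph dvd_d.
Let cell (a : Defs.arc G) : nat * nat := (val a.1, val a.2).

Lemma in_grid_cell (x : nat * nat) :
  in_grid p q x -> exists a : Defs.arc G, cell a = x.
Proof. by case: x => i j [/= ip jq]; exists (Ordinal ip, Ordinal jq). Qed.

Lemma cell_in_grid (a : Defs.arc G) : in_grid p q (cell a).
Proof. by split=> /=. Qed.

Lemma source_eqE (a b : Defs.arc G) :
  source a = source b <-> row_block q d (cell a) = row_block q d (cell b).
Proof. by split=> [/(congr1 val) | ab] //; apply: val_inj. Qed.

Lemma target_eqE (a b : Defs.arc G) :
  target a = target b <-> col_block p d (cell a) = col_block p d (cell b).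
Proof.
(* Truncated subtraction makes the reversal of blocks injective only below this bound. *)
have lt_col c : col_block p d (cell c) < p * q %/ d.
  by rewrite block_lt // [p * q]mulnC digits_lt ?ltn_ord.
split=> [/(congr1 val) | ab]; last apply: val_inj;
  rewrite /= !H_head_block //; last by rewrite -/(cell a) ab.
by rewrite -/(cell a) -/(cell b); have := lt_col a; have := lt_col b; lia.
Qed.

Lemma no_parallel_arcs_blocks : no_parallel_arcs G -> blocks_meet_once p q d.
Proof.
move=> H x y /in_grid_cell[a <-] /in_grid_cell[b <-].
by move=> /source_eqE sab /target_eqE tab; rewrite (H a b).
Qed.

Lemma arc_completion_blocks : arc_completion G -> blocks_complete p q d.
Proof.
move=> H x y z /in_grid_cell[a <-] /in_grid_cell[b <-] /in_grid_cell[c <-].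
move=> /source_eqE sab /target_eqE tbc; have [e [se te]] := H a b c sab tbc.
by exists (cell e); split; [apply: cell_in_grid | apply/source_eqE | apply/target_eqE].
Qed.

End GridOfArcs.

Theorem theorem3p3 (p q d : nat) (p_gt0 : 0 < p) (q_gt0 : 0 < q)
    (d_gt1 : 1 < d) (dvd_d : d %| p * q) :
  is_line_digraph (H_digraph dvd_d) -> d %| gcdn p q.
Proof.
move=> lineG; have d_gt0 := ltnW d_gt1.
have once : blocks_meet_once p q d.
  exact: no_parallel_arcs_blocks (line_digraph_no_parallel_arcs _ lineG).
have compl : blocks_complete p q d.
  exact: arc_completion_blocks (line_digraph_arc_completion _ lineG).
have le_dp : d <= p by apply: blocks_meet_once_leq once.
have le_dq : d <= q.
  by apply: blocks_meet_once_leq (blocks_meet_once_tr _ _ _ once); rewrite // mulnC.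
rewrite dvdn_gcd (blocks_complete_dvdn p q) // andbT.
by apply: (blocks_complete_dvdn q) => //; apply: blocks_complete_tr.
Qed.
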